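(* For any range map $\delta$, the product $\cdot$ of $\mathbf{Cl}_\delta$ satisfies, for any $u,v\in\mathsf{Cl}_\delta$, $$\mathsf{F}_u\cdot\mathsf{F}_v=\chi_\delta(u/v)\sum_{w\in[u/v,\;u\backslash v]}\mathsf{F}_w,$$ where $[u/v,\,u\backslash v]$ is an interval of the poset $\mathsf{Cl}_\delta(|u|+|v|)$ when $u/v$ is a $\delta$-cliff, and the right-hand side is read as $0$ when $\chi_\delta(u/v)=0$.
   Context: $\mathbb{K}$ is a field of characteristic zero, $\mathbb{N}=\{0,1,2,\dots\}$, $|u|$ is the length of a word $u$. A range map is a map $\delta:\mathbb{N}\setminus\{0\}\to\mathbb{N}$. A $\delta$-cliff of size $n$ is a word $u=u_1\cdots u_n$ of nonnegative integers with $u_i\leq\delta(i)$ for all $i$; $\mathsf{Cl}_\delta(n)$ is the set of them, ordered componentwise ($u\preccurlyeq v$ iff $u_i\leq v_i$ for all $i$), and $\mathsf{Cl}_\delta=\bigsqcup_{n\geq0}\mathsf{Cl}_\delta(n)$. $\mathbf{Cl}_\delta$ is the $\mathbb{K}$-vector space with basis $\{\mathsf{F}_u:u\in\mathsf{Cl}_\delta\}$. For a word $v\in\mathbb{N}^n$, $\mathrm{r}_\delta(v)\in\mathsf{Cl}_\delta(n)$ is defined by $\mathrm{r}_\delta(v)_i:=\min\{v_i,\delta(i)\}$. The product on $\mathbf{Cl}_\delta$ (the graded dual of the coproduct $\mathsf{F}_w\mapsto\sum_{w=uv}\mathsf{F}_u\otimes\mathsf{F}_{\mathrm{r}_\delta(v)}$)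 is the bilinear map given by $$\mathsf{F}_u\cdot\mathsf{F}_v=\sum_{v'}\mathsf{F}_{uv'},$$ the sum being over all words $v'\in\mathbb{N}^{|v|}$ such that $\mathrm{r}_\delta(v')=v$ and $uv'\in\mathsf{Cl}_\delta$. For $u,v\in\mathsf{Cl}_\delta$, $u/v:=uv$ is the concatenation and $u\backslash v:=uv'$, where $v'$ is the word of length $|v|$ with $v'_i=\delta(|u|+i)$ if $v_i=\delta(i)$ and $v'_i=v_i$ otherwise. For a word $x$ on $\mathbb{N}$, $\chi_\delta(x)=1$ if $x\in\mathsf{Cl}_\delta$ and $\chi_\delta(x)=0$ otherwise. *)

(* Defs.v *)
From HB Require Import structures.
From mathcomp Require Import all_boot all_order all_algebra finmap.
From mathcomp Require Import boolp classical_sets functions cardinality fsbigop.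
From mathcomp Require Import monalg.

Set Implicit Arguments.
Unset Strict Implicit.
Unset Printing Implicit Defensive.

Import Order.TTheory GRing.Theory.

Local Open Scope ring_scope.

(* [tupleprod] carries the componentwise order.  The letter in position i     *)
(* (numbered from 1, as is the domain of a range map) is [tnth w (i - 1)].    *)
Notation word n := (n.-tupleprod nat).

(* A range map is a [d : nat -> nat] whose value at 0 is never used.          *)
Definition is_cliff (d : nat -> nat) n (w : word n) : bool :=
  [forall i : 'I_n, (tnth w i <= d i.+1)%N].

Record cliff (d : nat -> nat) n :=
  Cliff { cliff_val :> word n; cliffP : is_cliff d cliff_val }.

HB.instance Definition _ d n := [isSub for @cliff_val d n].
HB.instance Definition _ d n := [Choice of cliff d n by <:].

Section CliffFinite.
Variables (d : nat -> nat) (n : nat).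

Definition cliff_code (w : cliff d n) : {dffun forall i : 'I_n, 'I_(d i.+1).+1} :=
  [ffun i => inord (tnth (cliff_val w) i)].

Definition cliff_decode (f : {dffun forall i : 'I_n, 'I_(d i.+1).+1}) :
  option (cliff d n) := insub [tuple (f i : nat) | i < n].

Lemma cliff_codeK : pcancel cliff_code cliff_decode.
Proof.
move=> a; rewrite /cliff_decode.
have -> : [tuple (cliff_code a i : nat) | i < n] = cliff_val a.
  apply: eq_from_tnth => i; rewrite tnth_mktuple ffunE inordK // ltnS.
  by move/forallP: (cliffP a).
by rewrite (valK a).
Qed.

HB.instance Definition _ := isCountable.Build (cliff d n)
  (pcan_pickleK cliff_codeK).
HB.instance Definition _ := isFinite.Build (cliff d n)
  (pcan_enumP cliff_codeK).

End CliffFinite.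

Definition reduction (d : nat -> nat) n (v : word n) : word n :=
  [tuple minn (tnth v i) (d i.+1) | i < n].

Definition wcat m n (u : word m) (v : word n) : word (m + n) := cat_tuple u v.

Definition wover m n (u : word m) (v : word n) : word (m + n) := wcat u v.

Definition wunder (d : nat -> nat) m n (u : word m) (v : word n) :
    word (m + n) :=
  wcat u
    [tuple if tnth v i == d i.+1 then d (m + i.+1)%N else tnth v i | i < n].

(* Cliffs of size [n] inherit the order of [word n]; the bounds are words so   *)
(* that the interval can be written before they are known to be cliffs.       *)
Definition cliff_interval (d : nat -> nat) n (x y : word n) : {pred cliff d n} :=
  [pred w : cliff d n | (x <= cliff_val w <= y)%O].
Arguments cliff_interval d {n} x y.

(* The free K-module on all cliffs, of every size.                            *)
Notation Cl K d := {malg K[{n : nat & cliff d n}]}.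

Section Algebra.
Variables (K : fieldType) (d : nat -> nat).

Definition cliffF n (w : cliff d n) : Cl K d := << Tagged (cliff d) w >>.

(* The default value 0 is never reached in [Fmul], where all words are cliffs. *)
Definition wordF n (w : word n) : Cl K d := oapp (@cliffF n) 0 (insub w).

Definition chi n (w : word n) : K := (is_cliff d w)%:R.

Definition extensions m n (u : cliff d m) (v : cliff d n) : set (word n) :=
  [set v' | reduction d v' = v /\ is_cliff d (wcat u v')]%classic.

(* [Fmul] sums over this set with [\sum_(_ \in _)], whose value is the actual  *)
(* sum only for finite support.                                               *)
Lemma finite_extensions m n (u : cliff d m) (v : cliff d n) :
  finite_set (extensions u v).
Proof.
have inj : injective (@wcat m n u).
  move=> v1 v2 /(congr1 val) /= /eqP; rewrite eqseq_cat // eqxx /= => /eqP.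
  exact: val_inj.
have: finite_set (@cliff_val d (m + n) @` [set: cliff d (m + n)])%classic.
  exact/finite_image/finite_finset.
move/(finite_preimage (f := @wcat m n u) (fun x y _ _ => @inj x y)).
apply: sub_finite_set => v' [_ cuv'].
by exists (Cliff cuv').
Qed.

Definition Fmul m n (u : cliff d m) (v : cliff d n) : Cl K d :=
  \sum_(v' \in extensions u v) wordF (wcat u v').

(* The bilinear extension of [Fmul]. *)
Definition Clmul (x y : Cl K d) : Cl K d :=
  \sum_(a <- msupp x) \sum_(b <- msupp y)
     (x@_a * y@_b) *: Fmul (tagged a) (tagged b).

Lemma ClmulFF m n (u : cliff d m) (v : cliff d n) :
  Clmul (cliffF u) (cliffF v) = Fmul u v.
Proof.
by rewrite /Clmul !msuppU !oner_eq0 !big_seq_fset1 !mcoeffUU mulr1 scale1r.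
Qed.

Lemma Clmulw (x y : Cl K d) (A B : {fset {n : nat & cliff d n}}) :
  (msupp x `<=` A)%fset -> (msupp y `<=` B)%fset ->
  Clmul x y = \sum_(a <- A) \sum_(b <- B)
     (x@_a * y@_b) *: Fmul (tagged a) (tagged b).
Proof.
move=> xA yB; rewrite /Clmul (big_fset_incl _ xA) => [|a _ /mcoeff_outdom xa0].
  apply: eq_bigr => a _; apply: (big_fset_incl _ yB) => b _ /mcoeff_outdom yb0.
  by rewrite yb0 mulr0 scale0r.
by rewrite big1 // => b _; rewrite xa0 mul0r scale0r.
Qed.

Lemma Clmul_linearl y : linear (Clmul^~ y).
Proof.
move=> c x1 x2 /=.
pose A := (msupp x1 `|` msupp x2 `|` msupp (c *: x1 + x2))%fset.
have s1 : (msupp x1 `<=` A)%fset by rewrite /A -fsetUA fsubsetUl.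
have s2 : (msupp x2 `<=` A)%fset by rewrite /A fsetUAC fsubsetUr.
have s3 : (msupp (c *: x1 + x2) `<=` A)%fset by rewrite /A fsubsetUr.
rewrite (Clmulw s1 (fsubset_refl (msupp y))) (Clmulw s2 (fsubset_refl _)).
rewrite (Clmulw s3 (fsubset_refl _)).
rewrite scaler_sumr -big_split; apply: eq_bigr => a _ /=.
rewrite scaler_sumr -big_split; apply: eq_bigr => b _ /=.
by rewrite mcoeffD mcoeffZ mulrDl scalerDl scalerA mulrA.
Qed.

Lemma Clmul_linearr x : linear (Clmul x).
Proof.
move=> c y1 y2 /=.
pose B := (msupp y1 `|` msupp y2 `|` msupp (c *: y1 + y2))%fset.
have s1 : (msupp y1 `<=` B)%fset by rewrite /B -fsetUA fsubsetUl.
have s2 : (msupp y2 `<=` B)%fset by rewrite /B fsetUAC fsubsetUr.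
have s3 : (msupp (c *: y1 + y2) `<=` B)%fset by rewrite /B fsubsetUr.
rewrite (Clmulw (fsubset_refl (msupp x)) s1) (Clmulw (fsubset_refl _) s2).
rewrite (Clmulw (fsubset_refl _) s3).
rewrite scaler_sumr -big_split; apply: eq_bigr => a _ /=.
rewrite scaler_sumr -big_split; apply: eq_bigr => b _ /=.
by rewrite mcoeffD mcoeffZ mulrDr scalerDl scalerA mulrCA.
Qed.

End Algebra.

Arguments cliffF K {d n} w.
Arguments chi K d {n} w.

(* Main.v *)
Require Import Defs.
From mathcomp Require Import all_boot all_order all_algebra monalg.
From mathcomp Require Import classical_sets functions fsbigop.

(** The words [uv'] occurring in [F_u . F_v] share the prefix [u], and the two
    conditions on [v'] constrain each letter separately: with [a] a letter of
    [v], [k] the bound of [a] in [v] and [e] its bound in [uv], a letter [x]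
    at the same place in [v'] must satisfy [min x k = a] and [x <= e].  If
    [a < k], truncation at [k] did nothing, so [x = a]; if [a = k], truncation
    hides everything above [k], so [x] is any letter from [a] to [e].  These are
    the intervals of letters whose ends are the letters of [u/v] and
    [u\v].  This requires [a <= e], that is, that [uv] be a cliff
    ([mem_extensions]); otherwise some letter has no solution and the product
    is 0 ([extensions_cliff]).

    An interval between two words with prefix [u] contains only words with
    prefix [u], so its elements are the words [uv'] with [v'] between the two
    suffixes, and the sum over [v'] is a sum over the interval. *)

Set Implicit Arguments.
Unset Strict Implicit.
Unset Printing Implicit Defensive.

Import Order.TTheory GRing.Theory.
Local Open Scope ring_scope.

(** * Words with a given prefix *)

Lemma tnth_wcatl m n (u : word m) (v : word n) i :
  tnth (wcat u v) (lshift n i) = tnth u i.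
Proof. exact: tnth_lshift. Qed.

Lemma tnth_wcatr m n (u : word m) (v : word n) i :
  tnth (wcat u v) (rshift m i) = tnth v i.
Proof. exact: tnth_rshift. Qed.

Lemma le_wordP n (v w : word n) :
  reflect (forall i, (tnth v i <= tnth w i)%N) (v <= w)%O.
Proof. by rewrite leEtprod; apply: forallP. Qed.

Lemma le_wcat m n (u : word m) (v w : word n) :
  (wcat u v <= wcat u w)%O = (v <= w)%O.
Proof.
apply/le_wordP/le_wordP => le_vw i.
  by have := le_vw (rshift m i); rewrite !tnth_wcatr.
by case: (split_ordP i) => j ->; rewrite ?tnth_wcatl // !tnth_wcatr.
Qed.

Definition wsuffix m n (w : word (m + n)) : word n :=
  [tuple tnth w (rshift m i) | i < n].

Lemma wsuffix_wcat m n (u : word m) (v : word n) : wsuffix (wcat u v) = v.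
Proof. by apply: eq_from_tnth => i; rewrite tnth_mktuple tnth_wcatr. Qed.

(** On the prefix both bounds are [u], so antisymmetry applies letter by
    letter. *)
Lemma wcat_wsuffix m n (u : word m) (v1 v2 : word n) (w : word (m + n)) :
  (wcat u v1 <= w <= wcat u v2)%O -> wcat u (wsuffix w) = w.
Proof.
case/andP=> /le_wordP le1 /le_wordP le2; apply: eq_from_tnth => i.
case: (split_ordP i) => j ->; last by rewrite tnth_wcatr tnth_mktuple.
apply/eqP; rewrite eqn_leq.
have := le1 (lshift n j); have := le2 (lshift n j).
by rewrite !tnth_wcatl => -> ->.
Qed.

Lemma is_cliff_wcatP d m n (u : cliff d m) (v : word n) :
  reflect (forall i, (tnth v i <= d (m + i).+1)%N) (is_cliff d (wcat u v)).
Proof.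
apply: (iffP forallP) => cliff_uv i.
  by have := cliff_uv (rshift m i); rewrite tnth_wcatr.
case: (split_ordP i) => j ->; last by rewrite tnth_wcatr.
by rewrite tnth_wcatl; apply: (forallP (cliffP u)).
Qed.

(** * The words of the product *)

(** Truncation at [k] is injective below [k] and sends all the letters above
    [k] to [k].  For a letter of [v'], [k] and [e] are the bounds at its place in [v]
    and in [uv]. *)
Lemma minn_eq_interval (a e k x : nat) : (a <= k)%N -> (a <= e)%N ->
  ((minn x k == a) && (x <= e)%N) =
  (a <= x <= (if a == k then e else a))%N.
Proof.
move=> le_ak le_ae; case: (eqVneq a k) => [-> | neq_ak].
  by rewrite (sameP eqP minn_idPr).
have lt_ak : (a < k)%N by rewrite ltn_neqAle neq_ak.
rewrite -eqn_leq; case: (leqP x k) => [_ | lt_kx].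
  by case: eqVneq => [-> | _]; rewrite ?eqxx // eq_sym.
by rewrite [k == a]eq_sym (negPf neq_ak) (ltn_eqF (ltn_trans lt_ak lt_kx)).
Qed.

(** Truncation only lowers letters, and lowering letters keeps cliffs. *)
Lemma extensions_cliff d m n (u : cliff d m) (v : cliff d n) (v' : word n) :
  extensions u v v' -> is_cliff d (wcat u v).
Proof.
case=> <- /is_cliff_wcatP cliff_uv'; apply/is_cliff_wcatP => i.
by rewrite tnth_mktuple; apply: leq_trans (geq_minl _ _) (cliff_uv' i).
Qed.

(** The suffix of [u\v], where [u] has length [m]. *)
Definition wraise (d : nat -> nat) m n (v : word n) : word n :=
  [tuple if tnth v i == d i.+1 then d (m + i.+1)%N else tnth v i | i < n].

Lemma wunderE d m n (u : word m) (v : word n) :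
  wunder d u v = wcat u (wraise d m v).
Proof. by []. Qed.

(** Both sides are conjunctions over the letters of [v'], to which
    [minn_eq_interval] applies one by one. *)
Lemma mem_extensions d m n (u : cliff d m) (v : cliff d n) (v' : word n) :
  is_cliff d (wcat u v) ->
  extensions u v v' <-> (cliff_val v <= v' <= wraise d m v)%O.
Proof.
move=> /is_cliff_wcatP cliff_uv.
have letterP i := minn_eq_interval (tnth v' i)
  (forallP (cliffP v) i) (cliff_uv i).
split=> [[red_v' /is_cliff_wcatP cliff_uv'] | /andP[/le_wordP le1 /le_wordP le2]].
  have in_letter i : (tnth (cliff_val v) i <= tnth v' i <= tnth (wraise d m v) i)%N.
    by rewrite tnth_mktuple addnS -letterP cliff_uv' -red_v' tnth_mktuple eqxx.
  by apply/andP; split; apply/le_wordP => i; case/andP: (in_letter i).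
have in_letter i : (minn (tnth v' i) (d i.+1) == tnth (cliff_val v) i)
    && (tnth v' i <= d (m + i).+1)%N.
  by rewrite letterP le1 /=; have := le2 i; rewrite tnth_mktuple addnS.
split; last by apply/is_cliff_wcatP => i; case/andP: (in_letter i).
apply: eq_from_tnth => i; rewrite tnth_mktuple.
by case/andP: (in_letter i) => /eqP.
Qed.

Lemma wraise_extension d m n (u : cliff d m) (v : cliff d n) :
  is_cliff d (wcat u v) -> extensions u v (wraise d m v).
Proof.
move=> cliff_uv; apply/mem_extensions => //; rewrite lexx andbT.
apply/le_wordP => i; rewrite tnth_mktuple addnS; case: ifP => // _.
exact: (is_cliff_wcatP _ _ cliff_uv).
Qed.

(** The inverse is [wcat u], since every word of the interval has prefix
    [u]. *)
Lemma wsuffix_interval_bij d m n (u : cliff d m) (v : cliff d n) :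
  is_cliff d (wover u v) ->
  set_bij [set` cliff_interval d (wover u v) (wunder d u v)] (extensions u v)
    (fun w : cliff d (m + n) => wsuffix w).
Proof.
move=> cliff_uv; split=> [w | w1 w2 /set_mem w1P /set_mem w2P eq_suffix | v' ext_v'].
- move=> /= w_in; apply/(mem_extensions _ cliff_uv).
  by rewrite -(le_wcat u v) -(le_wcat u (wsuffix w)) (wcat_wsuffix w_in).
- by apply: val_inj; rewrite /= -(wcat_wsuffix w1P) eq_suffix (wcat_wsuffix w2P).
exists (Cliff ext_v'.2); last by rewrite /= wsuffix_wcat.
rewrite /= inE /= /wover wunderE !le_wcat.
by apply/(mem_extensions _ cliff_uv).
Qed.

Theorem theorem3p1p4 (K : fieldType) (charK : [pchar K] =i pred0)
    (d : nat -> nat) (m n : nat) (u : cliff d m) (v : cliff d n) :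
  (is_cliff d (wover u v) ->
     is_cliff d (wunder d u v) /\ (wover u v <= wunder d u v)%O) /\
  Clmul (cliffF K u) (cliffF K v) =
    chi K d (wover u v) *:
      \sum_(w in cliff_interval d (wover u v) (wunder d u v)) cliffF K w.
Proof.
split=> [cliff_uv |].
  have ext := wraise_extension cliff_uv.
  split; first exact: ext.2.
  by rewrite /wover wunderE le_wcat; case/mem_extensions/andP: ext.
rewrite ClmulFF /Fmul /chi; case: (boolP (is_cliff d _)) => [cliff_uv | ncliff_uv].
  rewrite scale1r (reindex_fsbig _ _ _ _ (wsuffix_interval_bij cliff_uv)).
  rewrite [RHS]bigfs ?index_enum_uniq // => [|w _]; last by rewrite mem_index_enum.
  apply: eq_fsbigr => w /set_mem /= w_in.
  by rewrite (wcat_wsuffix w_in) /wordF valK.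
rewrite scale0r (_ : extensions u v = set0) ?fsbig_set0 //.
by apply/seteqP; split=> // v' /extensions_cliff; apply/negP.
Qed.
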